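(* Let $\pi=(\pi^1,\dots,\pi^n)$ be sampled uniformly at random from the set $\Pi$ of all permutations of $\{1,\dots,n\}$, and let $\delta\in(0,1)$. Then, for any $x\in\mathbb{R}^d$ and any integer $1\le m\le n$, with probability at least $1-\delta$, $$\left\|\sum_{i=1}^m\left(\nabla f_{\pi^i}(x)-\nabla f(x)\right)\right\|^2\le 4n\left(A\,(f(x)-\bar f)+B\right)\log^2(8/\delta).$$
   Context: Here $f(x)=\frac1n\sum_{i=1}^n f_i(x)$ on $\mathbb{R}^d$. Each $f_i:\mathbb{R}^d\to\mathbb{R}$ is continuously differentiable (not necessarily convex), bounded from below by $\bar f_i\in\mathbb{R}$, and $\nabla f_i$ is Lipschitz continuous with parameter $L>0$. Let $\bar f$ be a lower bound of $f$ (e.g. its optimal value), and set $A=2L>0$ and $B=\frac{A}{n}\sum_{i=1}^n(\bar f-\bar f_i)$, with $\bar f$ such that $B\ge0$ (automatic if $\bar f=\inf f$). $\|\cdot\|$ is the Euclidean norm. The point $x$ and the integer $m$ are fixed (deterministic). *)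

(* Defs.v *)
From HB Require Import structures.
From mathcomp Require Import all_boot all_order all_algebra all_fingroup.
From mathcomp Require Import all_classical all_reals all_analysis.

Set Implicit Arguments.
Unset Strict Implicit.
Unset Printing Implicit Defensive.

Import Order.TTheory GRing.Theory Num.Theory.
Import numFieldNormedType.Exports.

Local Open Scope classical_set_scope.
Local Open Scope ring_scope.

(* The norm `|v| that the library puts on row vectors is the sup norm, so the
   Euclidean norm is defined separately; both induce the same topology. *)
Definition enorm (R : realType) (d : nat) (v : 'rV[R]_d) : R :=
  Num.sqrt (\sum_(j < d) v ord0 j ^+ 2).

Definition grad (R : realType) (d : nat) (g : 'rV[R]_d -> R) (x : 'rV[R]_d) :
    'rV[R]_d :=
  \row_(j < d) 'D_(delta_mx ord0 j) g x.

Definition continuously_differentiable (R : realType) (d : nat)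
    (g : 'rV[R]_d -> R) : Prop :=
  (forall x, differentiable g x) /\ continuous (grad g).

Definition grad_lipschitz (R : realType) (d : nat) (L : R)
    (g : 'rV[R]_d -> R) : Prop :=
  forall x y, enorm (grad g x - grad g y) <= L * enorm (x - y).

Definition average (R : realType) (d n : nat) (f : 'I_n -> 'rV[R]_d -> R)
    (x : 'rV[R]_d) : R :=
  n%:R^-1 * \sum_(i < n) f i x.

(* The events [pi = s] are required to be measurable; since there are finitely
   many permutations, this makes every event about pi measurable. *)
Definition uniform_random_perm (R : realType) (disp : measure_display)
    (T : measurableType disp) (P : probability T R) (n : nat)
    (pi : T -> {perm 'I_n}) : Prop :=
  forall s : {perm 'I_n},
    measurable (pi @^-1` [set s]) /\
    P (pi @^-1` [set s]) = (#|{: {perm 'I_n}}|%:R^-1)%:E.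

(* Main.v *)
(** Put [v i := grad (f i) x - grad (average f) x], so that [\sum_i v i = 0].
    The descent lemma gives [|grad (f i) x|^2 <= 2 L (f i x - fbari i)], whence
    [\sum_i |v i|^2 <= W := n (A (average f x - fbar) + B)].

    Let [S m] be the sum of the first [m] terms of [v] in the random order and
    [M] the maximum over [m] of [E exp (|S m|^2 / 16 W)].  Since
    [S m] and [- S (n - m)] have the same law, the maximum is reached at some
    [m] with [2 m <= n].  For such an [m], [S m = (S (2 m) + D) / 2] with
    [D := \sum_(i < m) (v (pi i) - v (pi (m + i)))], and convexity gives
    [M <= (M + E exp (|D|^2 / 16 W)) / 2], i.e. [M <= E exp (|D|^2 / 16 W)].
    Exchanging the positions [i] and [m + i] flips the sign of the [i]-th term
    of [D] only, so [D] is a Rademacher sum, whose exponential moment is at most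
    [exp (1 / 4)].  Markov's inequality concludes. *)

Require Import Defs.
From HB Require Import structures.
From mathcomp Require Import all_boot all_order all_algebra all_fingroup.
From mathcomp Require Import all_classical all_reals all_analysis.
From mathcomp Require Import ring lra zify.

Set Implicit Arguments.
Unset Strict Implicit.
Unset Printing Implicit Defensive.

Import Order.TTheory GRing.Theory Num.Theory.
Import numFieldNormedType.Exports.

Local Open Scope classical_set_scope.
Local Open Scope ring_scope.

(** * Euclidean inner product *)

Definition dotv (R : realType) (d : nat) (u v : 'rV[R]_d) : R :=
  \sum_(j < d) u ord0 j * v ord0 j.

Lemma dotvC (R : realType) (d : nat) (u v : 'rV[R]_d) : dotv u v = dotv v u.
Proof. by apply: eq_bigr => j _; rewrite mulrC. Qed.

Lemma dotvDl (R : realType) (d : nat) (u v w : 'rV[R]_d) :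
  dotv (u + v) w = dotv u w + dotv v w.
Proof. by rewrite -big_split; apply: eq_bigr => j _; rewrite mxE mulrDl. Qed.

Lemma dotvZl (R : realType) (d : nat) (a : R) (u w : 'rV[R]_d) :
  dotv (a *: u) w = a * dotv u w.
Proof. by rewrite mulr_sumr; apply: eq_bigr => j _; rewrite mxE mulrA. Qed.

Lemma dotvDr (R : realType) (d : nat) (u v w : 'rV[R]_d) :
  dotv w (u + v) = dotv w u + dotv w v.
Proof. by rewrite dotvC dotvDl !(dotvC w). Qed.

Lemma dotvZr (R : realType) (d : nat) (a : R) (u w : 'rV[R]_d) :
  dotv w (a *: u) = a * dotv w u.
Proof. by rewrite dotvC dotvZl dotvC. Qed.

Lemma dotvNl (R : realType) (d : nat) (u w : 'rV[R]_d) :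
  dotv (- u) w = - dotv u w.
Proof. by rewrite -scaleN1r dotvZl mulN1r. Qed.

Lemma dotvNr (R : realType) (d : nat) (u w : 'rV[R]_d) :
  dotv w (- u) = - dotv w u.
Proof. by rewrite dotvC dotvNl dotvC. Qed.

Definition dotvE := (dotvDl, dotvDr, dotvNl, dotvNr, dotvZl, dotvZr).

Lemma dotvv_ge0 (R : realType) (d : nat) (u : 'rV[R]_d) : 0 <= dotv u u.
Proof. by apply: sumr_ge0 => j _; rewrite -expr2 sqr_ge0. Qed.

Lemma dotvv_eq0 (R : realType) (d : nat) (u : 'rV[R]_d) :
  dotv u u = 0 -> u = 0.
Proof.
move=> /eqP; rewrite psumr_eq0; last by move=> j _; rewrite -expr2 sqr_ge0.
move=> /allP u0; apply/rowP => j; rewrite mxE.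
by have /= := u0 j (mem_index_enum j); rewrite mulf_eq0 orbb => /eqP.
Qed.

Lemma enorm_sqr (R : realType) (d : nat) (u : 'rV[R]_d) :
  enorm u ^+ 2 = dotv u u.
Proof. by rewrite sqr_sqrtr// sumr_ge0// => j _; rewrite sqr_ge0. Qed.

Lemma dotv_cauchy_schwarz (R : realType) (d : nat) (u v : 'rV[R]_d) :
  dotv u v ^+ 2 <= dotv u u * dotv v v.
Proof.
have [v0|vN0] := eqVneq (dotv v v) 0.
  have -> : dotv u v = 0.
    by rewrite (dotvv_eq0 v0) -(scale0r 0) dotvZr mul0r.
  by rewrite expr0n mulr_ge0 ?dotvv_ge0.
have v_gt0 : 0 < dotv v v by rewrite lt_def vN0 dotvv_ge0.
(* This squared norm equals [b * (a * b - c ^+ 2)] in the notation below. *)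
have := dotvv_ge0 (dotv v v *: u - dotv u v *: v).
rewrite !dotvE (dotvC v u).
set a := dotv u u; set b := dotv v v; set c := dotv u v => h.
have : 0 <= b * (a * b - c ^+ 2) by lra.
by rewrite pmulr_rge0// subr_ge0.
Qed.

Lemma dotv_le_enorm (R : realType) (d : nat) (u v : 'rV[R]_d) :
  dotv u v <= enorm u * enorm v.
Proof.
have h0 (w : 'rV[R]_d) : 0 <= enorm w by exact: sqrtr_ge0.
apply: le_trans (ler_norm _) _.
rewrite -[leRHS]ger0_norm ?mulr_ge0// -ler_sqr ?nnegrE ?normr_ge0//.
by rewrite !real_normK ?num_real// exprMn !enorm_sqr dotv_cauchy_schwarz.
Qed.

Lemma enormZ (R : realType) (d : nat) (a : R) (u : 'rV[R]_d) :
  0 <= a -> enorm (a *: u) = a * enorm u.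
Proof.
move=> a0; apply/eqP; rewrite -(@eqrXn2 _ 2) ?mulr_ge0 ?sqrtr_ge0//.
by rewrite exprMn !enorm_sqr !dotvE mulrA.
Qed.

(** * Gradients and the descent lemma *)

Lemma derive_grad (R : realType) (d : nat) (g : 'rV[R]_d -> R) (x v : 'rV[R]_d) :
  differentiable g x -> 'D_v g x = dotv (grad g x) v.
Proof.
move=> dg; rewrite deriveE// [in LHS](row_sum_delta v) linear_sum.
by apply: eq_bigr => j _; rewrite linearZ /= mxE deriveE// mulrC.
Qed.

Lemma is_derive_line (R : realType) (d : nat) (g : 'rV[R]_d -> R)
    (x v : 'rV[R]_d) (t : R) : differentiable g (t *: v + x) ->
  is_derive t 1 (fun s => g (s *: v + x)) (dotv (grad g (t *: v + x)) v).
Proof.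
move=> dg; rewrite -derive_grad//.
have : derivable g (t *: v + x) v by exact: diff_derivable.
rewrite /derivable /derive => cg.
have E : (fun h : R => h^-1 *: (g ((h *: (1 : R) + t) *: v + x) - g (t *: v + x)))
  = (fun h : R => h^-1 *: (g (h *: v + (t *: v + x)) - g (t *: v + x))).
  by apply/funext => h; rewrite [h *: 1]mulr1 scalerDl addrA.
by constructor; rewrite /derivable /derive /= E.
Qed.

Lemma descent_lemma (R : realType) (d : nat) (g : 'rV[R]_d -> R) (L : R)
    (x v : 'rV[R]_d) : (forall y, differentiable g y) -> grad_lipschitz L g ->
  g (x + v) <= g x + dotv (grad g x) v + L / 2 * dotv v v.
Proof.
move=> dg gL.
(* [h] is [g] along the segment minus the linear and quadratic terms of the bound. Its derivative is
   nonpositive for positive [t] by Cauchy-Schwarz and the Lipschitz bound, so [h 1 <= h 0]. *)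
pose h (t : R) := g (t *: v + x) - t * dotv (grad g x) v
  - t ^+ 2 * (L / 2 * dotv v v).
have hd (t : R) : is_derive t 1 h (dotv (grad g (t *: v + x)) v
   - dotv (grad g x) v - t * (L * dotv v v)).
  have := is_derive_line (dg (t *: v + x)) => ?.
  rewrite /h; apply: is_derive_eq.
  by rewrite /GRing.scale/=; field.
have : h 1 <= h 0.
  apply: (@ler0_derive1_le_cc R h 0 1); rewrite ?in_itv/= ?lexx ?ler01//.
  - move=> t; rewrite in_itv/= => /andP[/ltW t0 _].
    rewrite derive1E derive_val -dotvNl -dotvDl subr_le0.
    apply: le_trans (dotv_le_enorm _ _) _; rewrite -enorm_sqr.
    have := gL (t *: v + x) x; rewrite addrK enormZ// => gLt.
    have -> : t * (L * enorm v ^+ 2) = L * (t * enorm v) * enorm v by ring.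
    by rewrite ler_wpM2r ?sqrtr_ge0.
  - by apply: derivable_within_continuous => t _.
rewrite /h scale0r scale1r add0r (addrC v).
lra.
Qed.

(** A gradient step of length [L^-1], which minimises the quadratic upper bound, lowers that bound
    by [|grad g x|^2 / (2 L)], yet cannot bring it below [c]. *)
Lemma grad_sqr_le (R : realType) (d : nat) (g : 'rV[R]_d -> R) (L c : R)
    (x : 'rV[R]_d) : 0 < L -> (forall y, differentiable g y) ->
  grad_lipschitz L g -> (forall y, c <= g y) ->
  dotv (grad g x) (grad g x) <= 2 * L * (g x - c).
Proof.
move=> L0 dg gL cg.
have := le_trans (cg _) (descent_lemma x (- (L^-1 *: grad g x)) dg gL).
rewrite !dotvE; set q := dotv _ _ => h.
have : L * c <= L * (g x + - (L^-1 * q) + L / 2 * - - (L^-1 * (L^-1 * q))).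
  by rewrite ler_wpM2l// ltW.
have -> : L * (g x + - (L^-1 * q) + L / 2 * - - (L^-1 * (L^-1 * q))) =
  L * g x - q / 2 by field; rewrite gt_eqF.
lra.
Qed.

(** * Inequalities for exponentials and squared norms *)

Lemma cosh_le_expR_sqr (R : realType) (y : R) :
  expR y + expR (- y) <= 2 * expR (y ^+ 2).
Proof.
have [y1|y1] := leP 1 `|y|.
  have yy : `|y| <= y ^+ 2 by rewrite -real_normK ?num_real// expr2 ler_peMr.
  have := ler_norm y; have := ler_norm (- y); rewrite normrN => h1 h2.
  have : expR y <= expR (y ^+ 2) by rewrite ler_expR (le_trans h2).
  have : expR (- y) <= expR (y ^+ 2) by rewrite ler_expR (le_trans h1).
  lra.
(* From [1 - z <= expR (- z)] and its mirror image, the left side is at most [1 / (1 - z)^2 + 1 / (1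
   + z)^2 = 2 (1 + u) / (1 - u)^2], while [expR (y ^+ 2) = w ^+ 2 >= (1 + 2 u)^2]. A polynomial
   inequality on [0 <= u <= 1 / 4] remains. *)
pose z := y / 2; pose u := z ^+ 2.
have [z1 z2] : - (1 / 2) < z /\ z < 1 / 2.
  by move: y1; rewrite ltr_norml /z => /andP[]; lra.
have u0 : 0 <= u by exact: sqr_ge0.
have u1 : u <= 1 / 4 by rewrite /u; nra.
set p := expR z; set r := expR (- z); set w := expR (2 * u).
have -> : expR y = p ^+ 2 by rewrite /p -expRM_natl /z; congr expR; field.
have -> : expR (- y) = r ^+ 2 by rewrite /r -expRM_natl /z; congr expR; field.
have -> : expR (y ^+ 2) = w ^+ 2.
  by rewrite /w -expRM_natl /u /z; congr expR; field.
have p0 : 0 < p by exact: expR_gt0.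
have r0 : 0 < r by exact: expR_gt0.
have pr : p * r = 1 by rewrite /p /r expRxMexpNx_1.
have hp : (1 - z) * p <= 1.
  by rewrite -[leRHS]pr mulrC ler_pM2l// expR_ge1Dx.
have hr : (1 + z) * r <= 1 by rewrite -[leRHS]pr ler_pM2r// expR_ge1Dx.
have hw : 1 + 2 * u <= w by exact: expR_ge1Dx.
have hp2 : ((1 - z) * p) ^+ 2 <= 1 by rewrite exprn_ile1// mulr_ge0//; lra.
have hr2 : ((1 + z) * r) ^+ 2 <= 1 by rewrite exprn_ile1// mulr_ge0//; lra.
have hw2 : (1 + 2 * u) ^+ 2 <= w ^+ 2 by rewrite ler_sqr ?nnegrE; lra.
have U0 : 0 < (1 - u) ^+ 2 by rewrite exprn_gt0//; lra.
rewrite -(ler_pM2r U0).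
have -> : (p ^+ 2 + r ^+ 2) * (1 - u) ^+ 2 =
    ((1 - z) * p) ^+ 2 * (1 + z) ^+ 2 + ((1 + z) * r) ^+ 2 * (1 - z) ^+ 2.
  by rewrite /u; ring.
have h1 : ((1 - z) * p) ^+ 2 * (1 + z) ^+ 2 <= (1 + z) ^+ 2.
  by rewrite ler_piMl ?sqr_ge0.
have h2 : ((1 + z) * r) ^+ 2 * (1 - z) ^+ 2 <= (1 - z) ^+ 2.
  by rewrite ler_piMl ?sqr_ge0.
have h3 : (1 + 2 * u) ^+ 2 * (1 - u) ^+ 2 <= w ^+ 2 * (1 - u) ^+ 2.
  by rewrite ler_pM2r.
have h4 : (1 + z) ^+ 2 + (1 - z) ^+ 2 = 2 + 2 * u by rewrite /u; ring.
have h5 : 1 + u <= (1 + 2 * u) ^+ 2 * (1 - u) ^+ 2.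
  rewrite -subr_ge0.
  have -> : (1 + 2 * u) ^+ 2 * (1 - u) ^+ 2 - (1 + u) =
    u * (1 - 3 * u - 4 * u ^+ 2 + 4 * u ^+ 3) by ring.
  rewrite mulr_ge0//.
  have : 0 <= u ^+ 3 by rewrite exprn_ge0.
  nra.
lra.
Qed.

Lemma expR_midpoint_le (R : realType) (a b : R) :
  expR ((a + b) / 2) <= (expR a + expR b) / 2.
Proof.
have -> : (a + b) / 2 = a / 2 + b / 2 by ring.
rewrite expRD.
have -> : expR a = expR (a / 2) ^+ 2 by rewrite -expRM_natl; congr expR; field.
have -> : expR b = expR (b / 2) ^+ 2 by rewrite -expRM_natl; congr expR; field.
have := sqr_ge0 (expR (a / 2) - expR (b / 2)); lra.
Qed.

Lemma dotv_midpoint_le (R : realType) (d : nat) (u v : 'rV[R]_d) :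
  dotv (2^-1 *: (u + v)) (2^-1 *: (u + v)) <= (dotv u u + dotv v v) / 2.
Proof.
have := dotvv_ge0 (u - v); rewrite !dotvE (dotvC v u).
set a := dotv u u; set b := dotv v v; set c := dotv u v; lra.
Qed.

Lemma dotvB_le (R : realType) (d : nat) (u v : 'rV[R]_d) :
  dotv (u - v) (u - v) <= 2 * (dotv u u + dotv v v).
Proof. by have := dotvv_ge0 (u + v); rewrite !dotvE (dotvC v u); lra. Qed.

(* One sign of a Rademacher sum is averaged out. The denominator [K - 4 E]
   decreases with the mass [E] already integrated: this absorbs the cross term
   [4 <X, D>^2 <= 4 |X|^2 |D|^2], because
   [1 / k + 4 a / k^2 <= 1 / (k - 4 a)]. *)
Lemma expR_dotv_symmetrize_le (R : realType) (d : nat) (X D : 'rV[R]_d)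
    (E K : R) : 0 <= E -> 0 < K - 4 * (dotv D D + E) ->
  expR ((dotv (X + D) (X + D) + E) / (K - 4 * E)) +
  expR ((dotv (X - D) (X - D) + E) / (K - 4 * E)) <=
  2 * expR ((dotv X X + (dotv D D + E)) / (K - 4 * (dotv D D + E))).
Proof.
set D2 := dotv D D => E0; set k := K - 4 * E.
have -> : K - 4 * (D2 + E) = k - 4 * D2 by rewrite /k; ring.
move=> k0.
have := dotv_cauchy_schwarz X D.
rewrite !dotvE (dotvC D X) -/D2.
set x := dotv X X; set c := dotv X D => cs.
have D0 : 0 <= D2 by exact: dotvv_ge0.
have x0 : 0 <= x by exact: dotvv_ge0.
have k1 : 0 < k by lra.
have kN0 : k != 0 by rewrite gt_eqF.
have kN1 : k - 4 * D2 != 0 by rewrite gt_eqF.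
pose s := x + (D2 + E).
have -> : (x + c + (c + D2) + E) / k = s / k + 2 * c / k by rewrite /s; field.
have -> : (x - c + (- c - - D2) + E) / k = s / k - 2 * c / k.
  by rewrite /s; field.
rewrite -/s !expRD -mulrDr.
have h := cosh_le_expR_sqr (2 * c / k).
apply: (@le_trans _ _ (expR (s / k) * (2 * expR ((2 * c / k) ^+ 2)))).
  by rewrite ler_pM2l ?expR_gt0.
rewrite mulrCA ler_pM2l// -expRD ler_expR.
have s0 : 0 <= s by rewrite /s; lra.
(* Cauchy-Schwarz and [x <= s] give [c ^+ 2 <= s * D2]; what remains is [s] times
   [(k + 4 D2) (k - 4 D2) <= k^2]. *)
have xD : x * D2 <= s * D2 by rewrite ler_wpM2r// /s; lra.
have -> : s / k + (2 * c / k) ^+ 2 = (s * k + 4 * c ^+ 2) / k ^+ 2 by field.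
rewrite ler_pdivrMr ?exprn_gt0// mulrAC ler_pdivlMr//.
have h1 : (s * k + 4 * c ^+ 2) * (k - 4 * D2) <=
    (s * k + 4 * (s * D2)) * (k - 4 * D2) by rewrite ler_pM2r//; lra.
apply: le_trans h1 _; rewrite -subr_ge0.
have -> : s * k ^+ 2 - (s * k + 4 * (s * D2)) * (k - 4 * D2) =
  16 * s * D2 ^+ 2 by ring.
by rewrite !mulr_ge0 ?sqr_ge0.
Qed.

(** * Differences of paired positions as a Rademacher sum *)

Lemma sum_partial_inord (V : nmodType) (n m : nat) (F : 'I_n.+1 -> V) :
  (m <= n.+1)%N ->
  \sum_(i < n.+1 | (i < m)%N) F i = \sum_(0 <= i < m) F (inord i).
Proof.
move=> mn; rewrite (big_nat_widen 0 m n.+1)// big_mkord.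
by apply: eq_bigr => i _; rewrite inord_val.
Qed.

Lemma sum_nat_double (V : nmodType) (m : nat) (F : nat -> V) :
  \sum_(0 <= i < m + m) F i =
  \sum_(0 <= i < m) F i + \sum_(0 <= i < m) F (m + i)%N.
Proof. by rewrite !big_mkord big_split_ord. Qed.

(** Positions are naturals, so that [m + i] needs no bound proof; for [i < m] and [m + m <= n.+1],
    [inord] never falls back on its default. *)
Definition pair_diff (R : realType) (d n m : nat) (v : 'I_n.+1 -> 'rV[R]_d)
    (s : {perm 'I_n.+1}) (i : nat) : 'rV[R]_d :=
  v (s (inord i)) - v (s (inord (m + i))).

(** In [t * s] the factor [t] acts first, so multiplying on the left exchanges positions, not
    values. *)
Lemma pair_diff_tperm (R : realType) (d n m k i : nat)
    (v : 'I_n.+1 -> 'rV[R]_d) (s : {perm 'I_n.+1}) :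
  (m + m <= n.+1)%N -> (k < m)%N -> (i < m)%N ->
  pair_diff m v (tperm (inord k) (inord (m + k)) * s)%g i =
  if i == k then - pair_diff m v s i else pair_diff m v s i.
Proof.
move=> mn km im; rewrite /pair_diff !permM.
have [->|ik] := eqVneq i k; first by rewrite tpermL tpermR opprB.
by rewrite !tpermD// -val_eqE /= !inordK ; lia.
Qed.

(* Upper bound for [exp (|D|^2 / K)] once the signs of the terms of index at
   least [k] in [D = \sum_(i < m) pair_diff i] have been averaged out. *)
Definition symmetrized_exp (R : realType) (d n m : nat)
    (v : 'I_n.+1 -> 'rV[R]_d) (K : R) (k : nat) (s : {perm 'I_n.+1}) : R :=
  let X := \sum_(0 <= i < k) pair_diff m v s i in
  let T := \sum_(k <= i < m) dotv (pair_diff m v s i) (pair_diff m v s i) in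
  expR ((dotv X X + T) / (K - 4 * T)).

Lemma sum_symmetrized_exp_le (R : realType) (d n m : nat)
    (v : 'I_n.+1 -> 'rV[R]_d) (K : R) (k : nat) :
  (m + m <= n.+1)%N -> (k < m)%N ->
  (forall s, 0 < K - 4 *
    \sum_(k <= i < m) dotv (pair_diff m v s i) (pair_diff m v s i)) ->
  \sum_s symmetrized_exp m v K k.+1 s <= \sum_s symmetrized_exp m v K k s.
Proof.
move=> mn km K0.
pose t : {perm 'I_n.+1} := tperm (inord k) (inord (m + k)).
(* Of two copies of the left sum, one is reindexed by the transposition; for each [s] this pairs the
   two signs of the [k]-th term. *)
suff : (\sum_s symmetrized_exp m v K k.+1 s) *+ 2 <=
       (\sum_s symmetrized_exp m v K k s) *+ 2 by rewrite ler_pMn2r.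
rewrite -[leRHS]sumrMnl [leLHS]mulr2n {2}(reindex_inj (mulgI t)) -big_split /=.
apply: ler_sum => s _; rewrite /symmetrized_exp.
move: (K0 s); rewrite big_ltn// => {}K0.
have eT : \sum_(k.+1 <= i < m)
      dotv (pair_diff m v (t * s)%g i) (pair_diff m v (t * s)%g i)
  = \sum_(k.+1 <= i < m) dotv (pair_diff m v s i) (pair_diff m v s i).
  apply: eq_big_nat => i /andP[ki im]; by rewrite pair_diff_tperm// gtn_eqF.
have eX : \sum_(0 <= i < k) pair_diff m v (t * s)%g i =
    \sum_(0 <= i < k) pair_diff m v s i.
  apply: eq_big_nat => i /andP[_ ik].
  by rewrite pair_diff_tperm// ?ltn_eqF// (ltn_trans ik).
rewrite eT !big_nat_recr//= eX pair_diff_tperm// eqxx -[leRHS]mulr_natl.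
apply: expR_dotv_symmetrize_le; last exact: K0.
by apply: sumr_ge0 => i _; exact: dotvv_ge0.
Qed.

(** Uses [|a - b|^2 <= 2 (|a|^2 + |b|^2)], the pairs being disjoint. The bound is uniform in [s],
    which keeps the denominators [K - 4 T] positive for [K = 16 W]. *)
Lemma sum_dotv_pair_diff_le (R : realType) (d n m k : nat)
    (v : 'I_n.+1 -> 'rV[R]_d) (W : R) (s : {perm 'I_n.+1}) :
  (m + m <= n.+1)%N -> \sum_i dotv (v i) (v i) <= W ->
  \sum_(k <= i < m) dotv (pair_diff m v s i) (pair_diff m v s i) <= 2 * W.
Proof.
move=> mn vW.
have q0 (u : 'rV[R]_d) : 0 <= dotv u u by exact: dotvv_ge0.
apply: (@le_trans _ _
    (\sum_(0 <= i < m) dotv (pair_diff m v s i) (pair_diff m v s i))).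
  have [km|mk] := leqP k m; last by rewrite big_geq ?sumr_ge0 1?ltnW.
  by rewrite [leRHS](@big_cat_nat _ _ _ k)//= lerDr sumr_ge0.
apply: (@le_trans _ _ (2 * \sum_(0 <= i < m + m)
    dotv (v (s (inord i))) (v (s (inord i))))).
  rewrite sum_nat_double -big_split/= mulr_sumr.
  by apply: ler_sum => i _; exact: dotvB_le.
rewrite ler_pM2l// -(sum_partial_inord (fun i => dotv (v (s i)) (v (s i))))//.
apply: le_trans vW; rewrite [leRHS](reindex_inj (@perm_inj _ s))/=.
by rewrite [leRHS](bigID (fun i : 'I_n.+1 => (i < m + m)%N))/= lerDl sumr_ge0.
Qed.

Lemma sum_exp_pair_diff_le (R : realType) (d n m : nat)
    (v : 'I_n.+1 -> 'rV[R]_d) (W : R) :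
  (m + m <= n.+1)%N -> 0 < W -> \sum_i dotv (v i) (v i) <= W ->
  \sum_s expR (dotv (\sum_(0 <= i < m) pair_diff m v s i)
                    (\sum_(0 <= i < m) pair_diff m v s i) / (16 * W)) <=
  #|{: {perm 'I_n.+1}}|%:R * expR (1 / 4).
Proof.
move=> mn W0 vW.
have T2W k s := sum_dotv_pair_diff_le k s mn vW.
(* All signs are averaged out one by one, from [k = m], where only [X] is present, down to [k = 0],
   where only [T] is. *)
have H k : (k <= m)%N -> \sum_s symmetrized_exp m v (16 * W) k s <=
                         \sum_s symmetrized_exp m v (16 * W) 0 s.
  elim: k => // k IH km; apply: le_trans (IH (ltnW km)).
  by apply: sum_symmetrized_exp_le => // s; have := T2W k s; lra.
have := H m (leqnn m); rewrite /symmetrized_exp.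
under eq_bigr do
  rewrite [X in _ + X]big_geq// [X in _ - _ * X]big_geq// addr0 mulr0 subr0.
move=> /le_trans; apply.
set e := expR (1 / 4).
have -> : #|{: {perm 'I_n.+1}}|%:R * e = \sum_(s : {perm 'I_n.+1}) e.
  by rewrite sumr_const mulr_natl.
apply: ler_sum => s _; rewrite /e.
rewrite ler_expR big_nil.
have -> : dotv (0 : 'rV[R]_d) 0 = 0 by rewrite -(scale0r 0) dotvZl mul0r.
(* Since [T <= 2 W], [T / (16 W - 4 T) <= 2 W / (8 W) = 1 / 4]. *)
have := T2W 0 s; set T := \sum_(0 <= i < m) _ => TW.
by rewrite add0r ler_pdivrMr; lra.
Qed.

(** * Exponential moments of partial sums *)

Definition partial_sum (R : realType) (d n m : nat) (v : 'I_n -> 'rV[R]_d)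
    (s : {perm 'I_n}) : 'rV[R]_d :=
  \sum_(i < n | (i < m)%N) v (s i).

(* Not divided by the number of permutations. *)
Definition exp_moment (R : realType) (d n m : nat) (v : 'I_n -> 'rV[R]_d)
    (K : R) : R :=
  \sum_s expR (dotv (partial_sum m v s) (partial_sum m v s) / K).

Lemma exp_moment_compl (R : realType) (d n m : nat) (v : 'I_n -> 'rV[R]_d)
    (K : R) : (m <= n)%N -> \sum_i v i = 0 ->
  exp_moment (n - m) v K = exp_moment m v K.
Proof.
move=> mn v0; rewrite /exp_moment.
rewrite [RHS](reindex_inj (mulgI (perm (@rev_ord_inj n)))).
apply: eq_bigr => s _.
(* Reversal moves the last [m] terms to the front, and these are the complement of the first [n - m]
   in a zero total. *)
suff -> : partial_sum m v (perm (@rev_ord_inj n) * s)%g = - partial_sum (n - m) v s.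
  by rewrite dotvNl dotvNr opprK.
apply/eqP; rewrite -addr_eq0; apply/eqP.
rewrite /partial_sum (reindex_inj rev_ord_inj)/= addrC.
rewrite -{}[RHS]v0 [RHS](reindex_inj (@perm_inj _ s))/=.
rewrite [RHS](bigID (fun i : 'I_n => (i < n - m)%N))/=; congr (_ + _).
apply: eq_big => [i|i _]; last by rewrite permM permE rev_ordK.
by have := ltn_ord i; lia.
Qed.

Lemma exp_moment_double (R : realType) (d n m : nat)
    (v : 'I_n.+1 -> 'rV[R]_d) (W : R) :
  (m + m <= n.+1)%N -> 0 < W -> \sum_i dotv (v i) (v i) <= W ->
  exp_moment m v (16 * W) <= (exp_moment (m + m) v (16 * W) +
    #|{: {perm 'I_n.+1}}|%:R * expR (1 / 4)) / 2.
Proof.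
move=> mn W0 vW.
have := sum_exp_pair_diff_le mn W0 vW; set Z := \sum_s _ => ZW.
apply: (@le_trans _ _ ((exp_moment (m + m) v (16 * W) + Z) / 2)); last lra.
rewrite /exp_moment /Z -big_split/= mulr_suml; apply: ler_sum => s _.
(* Convexity is used twice for each [s]: of the exponential, then of the squared norm at the
   midpoint of [S (2 m)] and [D]. *)
apply: le_trans (expR_midpoint_le _ _); rewrite ler_expR.
rewrite -mulrDl mulrAC ler_pM2r ?invr_gt0 ?mulr_gt0//.
suff -> : partial_sum m v s = 2^-1 *: (partial_sum (m + m) v s +
    \sum_(0 <= i < m) pair_diff m v s i) by exact: dotv_midpoint_le.
rewrite /partial_sum !(sum_partial_inord (fun i => v (s i)))//; last first.
  by rewrite (leq_trans _ mn)// leq_addr.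
rewrite sum_nat_double /pair_diff big_split/= sumrN.
set a := \sum_(0 <= i < m) _; set b := \sum_(0 <= i < m) _.
by rewrite addrACA subrr addr0 -mulr2n -(scaler_nat 2 a) scalerA mulVf ?scale1r.
Qed.

Lemma exp_moment_le (R : realType) (d n m : nat)
    (v : 'I_n.+1 -> 'rV[R]_d) (W : R) :
  (m <= n.+1)%N -> 0 < W -> \sum_i v i = 0 -> \sum_i dotv (v i) (v i) <= W ->
  exp_moment m v (16 * W) <= #|{: {perm 'I_n.+1}}|%:R * expR (1 / 4).
Proof.
move=> mn W0 v0 vW; set C := leRHS.
(* The lengths [0] to [n.+1] make [n.+2] cases. *)
pose F (i : 'I_n.+2) := exp_moment i v (16 * W).
case: (@Order.TotalTheory.arg_maxP _ _ 'I_n.+2 ord0 xpredT F isT) => j _ jmax.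
have {}jmax k : (k <= n.+1)%N -> exp_moment k v (16 * W) <= F j.
  by rewrite -ltnS => kn; exact: (jmax (Ordinal kn) isT).
apply: le_trans (jmax m mn) _.
have [i in2 iE] : exists2 i, (i + i <= n.+1)%N & exp_moment i v (16 * W) = F j.
  have jn := ltn_ord j.
  have [jj|jj] := leqP (j + j) n.+1; first by exists j.
  exists (n.+1 - j)%N; first by lia.
  by rewrite exp_moment_compl.
(* The doubled length is again dominated by the maximum: [F j <= (F j + C) / 2], hence
   [F j <= C]. *)
by have := jmax _ in2; have := exp_moment_double in2 W0 vW; rewrite iE -/C; lra.
Qed.

(** * Tail bound by counting permutations *)

Lemma card_perm_deviation_le (R : realType) (d n m : nat)
    (v : 'I_n.+1 -> 'rV[R]_d) (W delta : R) :
  (m <= n.+1)%N -> 0 <= W -> \sum_i v i = 0 -> \sum_i dotv (v i) (v i) <= W ->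
  0 < delta -> delta < 1 ->
  #|[pred s | ~~ (dotv (partial_sum m v s) (partial_sum m v s) <=
                  4 * W * ln (8 / delta) ^+ 2)]|%:R <=
  #|{: {perm 'I_n.+1}}|%:R * delta.
Proof.
move=> mn; rewrite le_eqVlt => /predU1P[<-|W0] v0 vW d0 d1.
  (* For [W = 0] the exponent [1 / (16 W)] is meaningless, but all vectors vanish. *)
  have vz i : v i = 0.
    apply: dotvv_eq0; apply/le_anti; rewrite dotvv_ge0 andbT.
    apply: le_trans vW; rewrite (bigD1 i)//= lerDl sumr_ge0// => k _.
    exact: dotvv_ge0.
  rewrite eq_card0 => [|s]; first by rewrite mulr_ge0// ltW.
  rewrite !inE; apply/negbF.
  have -> : partial_sum m v s = 0 by apply: big1 => i _.
  by rewrite -(scale0r 0) dotvZl mul0r mulr0 mul0r lexx.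
set l := ln _; set N := #|{: {perm 'I_n.+1}}|%:R; set b := #|_|.
(* Follows from [expR (1 / 2) <= 2]. The closing estimate [1 / 4 - l^2 / 4 <= ln 8 - l] rests on it,
   together with [l - 1 <= l^2 / 4]. *)
have l8 : 3 / 2 <= ln (8 : R).
  rewrite -ler_expR lnK ?posrE// (expRM_natl 3 2^-1).
  have -> : 8 = 2 ^+ 3 :> R by rewrite -natrX.
  rewrite lerXn2r ?nnegrE ?expR_ge0// -[leLHS]invrK -expRN.
  rewrite invf_ple ?posrE ?expR_gt0//.
  by apply: le_trans (expR_ge1Dx _); lra.
have lE : delta = expR (ln 8 - l).
  rewrite /l ln_div ?posrE// opprB addrCA subrr addr0 lnK ?posrE//.
(* Markov's inequality: each deviating permutation contributes at least
   [expR (4 W l^2 / (16 W))]. *)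
have : b%:R * expR (l ^+ 2 / 4) <= N * expR (1 / 4).
  apply: le_trans (exp_moment_le mn W0 v0 vW).
  rewrite /exp_moment (bigID [pred s | ~~ (dotv (partial_sum m v s)
    (partial_sum m v s) <= 4 * W * l ^+ 2)])/=.
  rewrite mulr_natl -sumr_const -[leLHS]addr0 lerD ?sumr_ge0//.
  apply: ler_sum => s; rewrite inE -ltNge => /ltW sW.
  by rewrite ler_expR ler_pdivlMr ?mulr_gt0//; apply: le_trans sW; lra.
rewrite -ler_pdivlMr ?expR_gt0// => /le_trans; apply.
rewrite -mulrA ler_wpM2l// -expRB lE ler_expR.
have := sqr_ge0 (l / 2 - 1); lra.
Qed.

(** * From counting to probability *)

Lemma prob_uniform_random_perm (R : realType) (disp : measure_display)
    (T : measurableType disp) (P : probability T R) (n : nat)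
    (pi : T -> {perm 'I_n}) (Q : pred {perm 'I_n}) :
  uniform_random_perm P pi ->
  P [set w | Q (pi w)] = (#|Q|%:R / #|{: {perm 'I_n}}|%:R)%:E.
Proof.
move=> piU.
have -> : [set w | Q (pi w)] =
    \bigcup_(s in [set` Q]) pi @^-1` [set s].
  apply/seteqP; split => [w Qw|w [s + ws]]; last by rewrite -ws.
  by exists (pi w).
rewrite measure_fin_bigcup//; last 2 first.
- by move=> s1 s2 _ _ [w [<- <-]].
- by move=> s _; exact: (piU s).1.
rewrite -(@bigfs _ _ _ _ (index_enum {perm 'I_n})) ?index_enum_uniq//; last first.
  by move=> s _; rewrite mem_index_enum.
rewrite (eq_bigr (fun=> (#|{: {perm 'I_n}}|%:R^-1)%:E)); last first.
  by move=> s _; exact: (piU s).2.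
by rewrite sumEFin sumr_const mulr_natl.
Qed.

(** * Centring the gradients at their mean *)

Lemma grad_average (R : realType) (d n : nat) (f : 'I_n -> 'rV[R]_d -> R)
    (x : 'rV[R]_d) : (forall i, differentiable (f i) x) ->
  grad (average f) x = n%:R^-1 *: \sum_(i < n) grad (f i) x.
Proof.
move=> df; apply/rowP => j; rewrite !mxE summxE.
have -> : average f = n%:R^-1 *: (\sum_(i < n) f i).
  by apply/funext => y; rewrite /average fct_sumE.
have dd i : derivable (f i) x (delta_mx ord0 j) by exact: diff_derivable.
rewrite deriveZ; last by apply: derivable_sum => i; exact: dd.
rewrite derive_sum//; congr (_ * _).
by apply: eq_bigr => i _; rewrite mxE.
Qed.

Lemma sum_sub_mean (R : realType) (d n : nat) (u : 'I_n.+1 -> 'rV[R]_d) :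
  \sum_i (u i - n.+1%:R^-1 *: \sum_j u j) = 0.
Proof.
rewrite big_split/= sumrN sumr_const card_ord -scaler_nat scalerA.
by rewrite divff ?pnatr_eq0// scale1r subrr.
Qed.

Lemma sum_dotv_sub_mean_le (R : realType) (d n : nat)
    (u : 'I_n.+1 -> 'rV[R]_d) :
  \sum_i dotv (u i - n.+1%:R^-1 *: \sum_j u j) (u i - n.+1%:R^-1 *: \sum_j u j)
  <= \sum_i dotv (u i) (u i).
Proof.
set c := n.+1%:R^-1 *: _.
have dotv_suml (w : 'rV[R]_d) : \sum_i dotv (u i - c) w = 0.
  transitivity (dotv (\sum_i (u i - c)) w).
    rewrite /dotv exchange_big/=; apply: eq_bigr => j _.
    by rewrite summxE mulr_suml.
  by rewrite sum_sub_mean -(scale0r 0) dotvZl mul0r.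
(* The added terms sum to zero and make the comparison termwise: each summand becomes
   [|u i|^2 - |c|^2]. *)
have -> : \sum_i dotv (u i - c) (u i - c) =
    \sum_i (dotv (u i - c) (u i - c) + 2 * dotv (u i - c) c).
  by rewrite big_split/= -mulr_sumr dotv_suml mulr0 addr0.
clearbody c; apply: ler_sum => i _.
have := dotvv_ge0 c; rewrite !dotvE (dotvC c); lra.
Qed.

(** * The deviation bound for a uniform random permutation *)

Theorem theorem2p2 (R : realType) (d n : nat) (f : 'I_n -> 'rV[R]_d -> R)
    (fbari : 'I_n -> R) (fbar L A B : R)
    (f_C1 : forall i, continuously_differentiable (f i))
    (f_bounded : forall i y, fbari i <= f i y)
    (L_gt0 : 0 < L)
    (f_lipschitz : forall i, grad_lipschitz L (f i))
    (fbar_le : forall y, fbar <= average f y)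
    (A_def : A = 2 * L)
    (B_def : B = A / n%:R * \sum_(i < n) (fbar - fbari i))
    (B_ge0 : 0 <= B)
    (disp : measure_display) (T : measurableType disp) (P : probability T R)
    (pi : T -> {perm 'I_n}) (pi_uniform : uniform_random_perm P pi)
    (delta : R) (delta_gt0 : 0 < delta) (delta_lt1 : delta < 1)
    (x : 'rV[R]_d) (m : nat) (m_ge1 : (1 <= m)%N) (m_le_n : (m <= n)%N) :
  ((1 - delta)%:E <=
   P [set w | (enorm (\sum_(i < n | (i < m)%N)
                       (grad (f (pi w i)) x - grad (average f) x)) ^+ 2
              <= 4 * n%:R * (A * (average f x - fbar) + B)
                 * ln (8 / delta) ^+ 2)%R])%E.
Proof.
case: n => [|n] in f fbari f_C1 f_bounded f_lipschitz fbar_le B_def pi pi_uniform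
  m_le_n *; first by have := leq_trans m_ge1 m_le_n.
have df i y : differentiable (f i) y by have [] := f_C1 i.
pose v i := grad (f i) x - grad (average f) x.
have vE i : v i = grad (f i) x - n.+1%:R^-1 *: \sum_j grad (f j) x.
  by rewrite /v grad_average.
pose W := n.+1%:R * (A * (average f x - fbar) + B).
(* The choice of [B] makes [fbar] cancel, leaving exactly the sum of the bounds on the squared
   gradients. *)
have WE : W = \sum_i 2 * L * (f i x - fbari i).
  rewrite /W B_def A_def /average -mulr_sumr !sumrB sumr_const card_ord.
  rewrite -[fbar *+ _]mulr_natl.
  have : n.+1%:R != 0 :> R by rewrite pnatr_eq0.
  by move: n.+1%:R => k k0; field.
have v0 : \sum_i v i = 0 by under eq_bigr do rewrite vE; exact: sum_sub_mean.
have vW : \sum_i dotv (v i) (v i) <= W.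
  rewrite WE; under eq_bigr do rewrite vE.
  apply: le_trans (sum_dotv_sub_mean_le _) _; apply: ler_sum => i _.
  by apply: grad_sqr_le.
have W0 : 0 <= W by apply: le_trans vW; apply: sumr_ge0 => i _; exact: dotvv_ge0.
pose Q s := dotv (partial_sum m v s) (partial_sum m v s) <=
  4 * W * ln (8 / delta) ^+ 2.
have -> : [set w | (enorm (\sum_(i < n.+1 | (i < m)%N)
                       (grad (f (pi w i)) x - grad (average f) x)) ^+ 2
              <= 4 * n.+1%:R * (A * (average f x - fbar) + B)
                 * ln (8 / delta) ^+ 2)%R] = [set w | Q (pi w)].
  by apply/funext => w /=; rewrite enorm_sqr /Q /W !mulrA.
rewrite (prob_uniform_random_perm _ pi_uniform) lee_fin.
have N0 : 0 < #|{: {perm 'I_n.+1}}|%:R :> R.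
  by rewrite ltr0n; apply/card_gt0P; exists 1%g.
rewrite ler_pdivlMr//.
(* At most a fraction [delta] of the permutations violates [Q]; the rest satisfy it. *)
have := card_perm_deviation_le m_le_n W0 v0 vW delta_gt0 delta_lt1.
have -> : #|{: {perm 'I_n.+1}}| = (#|Q| + #|[pred s | ~~ Q s]|)%N.
  by rewrite cardC.
rewrite natrD /Q; lra.
Qed.
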